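(* Let $\Omega\subset\mathbb{R}^4$ be open, let $\nu:\Omega\to\mathbb{C}(\mathbf{i}_1)$, and let $f_0:\Omega\to\mathbb{C}(\mathbf{i}_1)$ be a nonvanishing solution of the complexified Schrödinger equation $(\triangle_{\mathbb{C}}-\nu(z_1,z_2))f=0$ in $\Omega$. Then for every twice continuously differentiable function $\varphi:\Omega\to\mathbb{C}(\mathbf{i}_1)$ the following equality holds on $\Omega$: $$(\triangle_{\mathbb{C}}-\nu)\varphi=4\left(\partial_{\omega^{\dagger_2}}+\frac{\partial_{\omega} f_0}{f_0}C\right)\left(\partial_{\omega}-\frac{\partial_{\omega} f_0}{f_0}C\right)\varphi .$$
   Context: The bicomplex numbers are the commutative real algebra $\mathbb{T}=\{w_0+w_1\mathbf{i}_1+w_2\mathbf{i}_2+w_3\mathbf{j} : w_0,\dots,w_3\in\mathbb{R}\}$ with $\mathbf{i}_1^2=\mathbf{i}_2^2=-1$, $\mathbf{j}^2=1$, $\mathbf{i}_1\mathbf{i}_2=\mathbf{i}_2\mathbf{i}_1=\mathbf{j}$. Put $\mathbb{C}(\mathbf{i}_1)=\{x+y\mathbf{i}_1: x,y\in\mathbb{R}\}$. Every $\omega\in\mathbb{T}$ is uniquely $\omega=z_1+z_2\mathbf{i}_2$ with $z_1,z_2\in\mathbb{C}(\mathbf{i}_1)$, and $\mathbb{T}$ is identified with $\mathbb{R}^4$ through $z_1=x_1+y_1\mathbf{i}_1$, $z_2=x_2+y_2\mathbf{i}_1$. The $\dagger_2$-conjugation is $(z_1+z_2\mathbf{i}_2)^{\dagger_2}=z_1-z_2\mathbf{i}_2$,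 and $C$ denotes the operator $CW=W^{\dagger_2}$ (applied pointwise to functions). A coefficient written in front of $C$ multiplies after conjugation. For $\mathbb{T}$-valued functions on open subsets of $\mathbb{R}^4$: $\partial_{z_k}=\frac12(\partial_{x_k}-\mathbf{i}_1\partial_{y_k})$ for $k=1,2$; $\partial_{\omega}=\frac12(\partial_{z_1}-\mathbf{i}_2\partial_{z_2})$; $\partial_{\omega^{\dagger_2}}=\frac12(\partial_{z_1}+\mathbf{i}_2\partial_{z_2})$; $\triangle_{\mathbb{C}}=\partial_{z_1}^2+\partial_{z_2}^2$. Functions are not assumed holomorphic in $z_1,z_2$. A solution of the second-order equation means a twice continuously differentiable function satisfying it pointwise. *)

(* Defs.v *)
From HB Require Import structures.
From mathcomp Require Import all_boot all_order all_algebra.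
From mathcomp Require Import all_classical all_reals all_analysis.
From mathcomp Require Import complex.
From mathcomp Require Import ring.
Set Implicit Arguments.
Unset Strict Implicit.
Unset Printing Implicit Defensive.
Import Order.TTheory GRing.Theory Num.Theory.
Import numFieldNormedType.Exports.
Local Open Scope classical_set_scope.
Local Open Scope ring_scope.
Local Open Scope complex_scope.

(* The bicomplex number z1 + z2 i2, where C(i1) is R[i] and i1 is its 'i;
   w0 + w1 i1 + w2 i2 + w3 j is thus z1 = w0 + w1 i1, z2 = w2 + w3 i1. *)
Record bicomplex (R : Type) := BiComplex { bc1 : R[i]; bc2 : R[i] }.

Section BicomplexChoice.
Context {R : Type}.
Definition pair_of_bc (w : bicomplex R) : R[i] * R[i] := (bc1 w, bc2 w).
Definition bc_of_pair (p : R[i] * R[i]) : bicomplex R := BiComplex p.1 p.2.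
Lemma pair_of_bcK : cancel pair_of_bc bc_of_pair. Proof. by case. Qed.
End BicomplexChoice.

HB.instance Definition _ (R : choiceType) :=
  Choice.copy (bicomplex R) (can_type (@pair_of_bcK R)).

Section BicomplexRing.
Context {R : rcfType}.
Local Notation BC := (bicomplex R).
Implicit Types (u v w : BC) (z : R[i]) (a : R).

Lemma bc_eq w w' : bc1 w = bc1 w' -> bc2 w = bc2 w' -> w = w'.
Proof. by case: w => ? ?; case: w' => ? ? /= -> ->. Qed.

Definition bc_add w w' : BC := BiComplex (bc1 w + bc1 w') (bc2 w + bc2 w').
Definition bc_opp w : BC := BiComplex (- bc1 w) (- bc2 w).

Lemma bc_addA : associative bc_add.
Proof. by move=> u v w; apply: bc_eq; rewrite /= addrA. Qed.
Lemma bc_addC : commutative bc_add.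
Proof. by move=> u v; apply: bc_eq; rewrite /= addrC. Qed.
Lemma bc_add0 : left_id (BiComplex 0 0) bc_add.
Proof. by move=> u; apply: bc_eq; rewrite /= add0r. Qed.
Lemma bc_addN : left_inverse (BiComplex 0 0) bc_opp bc_add.
Proof. by move=> u; apply: bc_eq; rewrite /= addNr. Qed.

HB.instance Definition _ :=
  GRing.isZmodule.Build BC bc_addA bc_addC bc_add0 bc_addN.

(* Multiplication determined by i2^2 = -1. *)
Definition bc_mul w w' : BC :=
  BiComplex (bc1 w * bc1 w' - bc2 w * bc2 w') (bc1 w * bc2 w' + bc2 w * bc1 w').

Lemma bc_mulA : associative bc_mul.
Proof. by move=> u v w; apply: bc_eq => /=; ring. Qed.
Lemma bc_mulC : commutative bc_mul.
Proof. by move=> u v; apply: bc_eq => /=; ring. Qed.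
Lemma bc_mul1 : left_id (BiComplex 1 0) bc_mul.
Proof. by move=> u; apply: bc_eq => /=; ring. Qed.
Lemma bc_mulD : left_distributive bc_mul bc_add.
Proof. by move=> u v w; apply: bc_eq => /=; ring. Qed.
Lemma bc_1_neq0 : BiComplex 1 0 != 0 :> BC.
Proof. by apply/eqP => -[/eqP]; rewrite oner_eq0. Qed.

HB.instance Definition _ := GRing.Zmodule_isComNzRing.Build BC
  bc_mulA bc_mulC bc_mul1 bc_mulD bc_1_neq0.

Definition bc_sqnorm w : R[i] := bc1 w ^+ 2 + bc2 w ^+ 2.

(* There are zero divisors: w is invertible iff z1^2 + z2^2 != 0.  As usual,
   the total inverse is the identity on non-invertible elements. *)
Definition bc_unit : pred BC := fun w => bc_sqnorm w != 0.
Definition bc_inv w : BC :=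
  if bc_unit w then BiComplex (bc1 w / bc_sqnorm w) (- bc2 w / bc_sqnorm w)
  else w.

Lemma bc_mulV : {in bc_unit, left_inverse 1 bc_inv *%R}.
Proof.
move=> w; rewrite /in_mem /= => wU; rewrite /bc_inv wU.
rewrite /bc_unit /bc_sqnorm in wU.
by apply: bc_eq => /=; rewrite /bc_sqnorm; field.
Qed.

Lemma bc_unitP w w' : w' * w = 1 -> bc_unit w.
Proof.
case=> e1 e2; apply/eqP => w0; have /eqP := oner_neq0 R[i]; apply.
have -> : 1 = bc_sqnorm w' * bc_sqnorm w :> R[i].
  transitivity ((1 : R[i]) ^+ 2 + 0 ^+ 2); first by ring.
  by rewrite -[in LHS]e1 -[in LHS]e2 /bc_sqnorm; ring.
by rewrite w0 mulr0.
Qed.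

Lemma bc_inv_out : {in [predC bc_unit], bc_inv =1 id}.
Proof. by move=> w; rewrite /in_mem /= /in_mem /= /bc_inv => /negbTE ->. Qed.

HB.instance Definition _ :=
  GRing.ComNzRing_hasMulInverse.Build BC bc_mulV bc_unitP bc_inv_out.

Definition bc_scale a w : BC := BiComplex (a%:C * bc1 w) (a%:C * bc2 w).

Lemma bc_scaleA a (b : R) w : bc_scale a (bc_scale b w) = bc_scale (a * b) w.
Proof. by apply: bc_eq; rewrite /= rmorphM mulrA. Qed.
Lemma bc_scale1 : left_id 1 bc_scale.
Proof. by move=> w; apply: bc_eq; rewrite /= mul1r. Qed.
Lemma bc_scaleDr : right_distributive bc_scale +%R.
Proof. by move=> a u v; apply: bc_eq; rewrite /= mulrDr. Qed.
Lemma bc_scaleDl w : {morph bc_scale^~ w : a b / a + b}.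
Proof. by move=> a b; apply: bc_eq; rewrite /= rmorphD mulrDl. Qed.

HB.instance Definition _ := GRing.Zmodule_isLmodule.Build R BC
  bc_scaleA bc_scale1 bc_scaleDr bc_scaleDl.

Lemma bc_scaleAl a u v : a *: (u * v) = (a *: u) * v.
Proof. by apply: bc_eq => /=; ring. Qed.

HB.instance Definition _ := GRing.Lmodule_isLalgebra.Build R BC bc_scaleAl.
HB.instance Definition _ := GRing.Lalgebra_isComAlgebra.Build R BC.

Definition bc_i1 : BC := BiComplex (0 +i* 1) 0.
Definition bc_i2 : BC := BiComplex 0 1.
Definition bc_j : BC := BiComplex 0 (0 +i* 1).

Definition bc_of_complex z : BC := BiComplex z 0.

Lemma bc_i1_sqr : bc_i1 ^+ 2 = -1.
Proof.
by rewrite expr2; apply: bc_eq;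
  apply/eqP; rewrite eq_complex /= !(mulr0, mul0r, mulr1, mul1r, add0r, addr0, subr0, oppr0) !eqxx.
Qed.
Lemma bc_i2_sqr : bc_i2 ^+ 2 = -1.
Proof. by rewrite expr2; apply: bc_eq => /=; ring. Qed.
Lemma bc_i1i2 : bc_i1 * bc_i2 = bc_j.
Proof. by apply: bc_eq => /=; ring. Qed.
Lemma bc_j_sqr : bc_j ^+ 2 = 1.
Proof. by rewrite -bc_i1i2 exprMn bc_i1_sqr bc_i2_sqr mulrNN mulr1. Qed.
Lemma bc_decomp w :
  w = bc_of_complex (bc1 w) + bc_of_complex (bc2 w) * bc_i2.
Proof. by apply: bc_eq => /=; ring. Qed.
Lemma bc_of_complex_unit z : (bc_of_complex z \is a GRing.unit) = (z != 0).
Proof.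
by rewrite unfold_in /= /bc_unit /bc_sqnorm /= expr0n addr0 expf_eq0.
Qed.

(* The conjugation (z1 + z2 i2)^{dagger_2} = z1 - z2 i2. *)
Definition dagger2 w : BC := BiComplex (bc1 w) (- bc2 w).

End BicomplexRing.

Section Calculus.
Context {R : realType}.
Local Notation BC := (bicomplex R).
Local Notation R4 := 'rV[R]_4.

(* A point of R^4 is the row vector (x1, y1, x2, y2). *)
Definition ix1 : 'I_4 := @Ordinal 4 0 isT.
Definition iy1 : 'I_4 := @Ordinal 4 1 isT.
Definition ix2 : 'I_4 := @Ordinal 4 2 isT.
Definition iy2 : 'I_4 := @Ordinal 4 3 isT.

Definition basis4 (k : 'I_4) : R4 := delta_mx 0 k.

(* g is of class C^n on the open set Omega: all its iterated partial
   derivatives of order at most n exist and are continuous on Omega. *)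
Fixpoint class_C (n : nat) (Omega : set R4) (g : R4 -> R) : Prop :=
  (forall p, Omega p -> {for p, continuous g}) /\
  if n is m.+1 then
    forall k : 'I_4, (forall p, Omega p -> derivable g p (basis4 k)) /\
                     class_C m Omega ('D_(basis4 k) g)
  else True.

Definition class_C_complex n Omega (f : R4 -> R[i]) : Prop :=
  class_C n Omega (fun p => complex.Re (f p)) /\
  class_C n Omega (fun p => complex.Im (f p)).

Definition partial_complex (k : 'I_4) (f : R4 -> R[i]) (p : R4) : R[i] :=
  'D_(basis4 k) (fun q => complex.Re (f q)) p +i*
  'D_(basis4 k) (fun q => complex.Im (f q)) p.

(* Partial derivative of a bicomplex-valued function, taken on the four real
   components. *)
Definition partial (k : 'I_4) (W : R4 -> BC) (p : R4) : BC :=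
  BiComplex (partial_complex k (fun q => bc1 (W q)) p)
            (partial_complex k (fun q => bc2 (W q)) p).

Definition dz1 (W : R4 -> BC) (p : R4) : BC :=
  2^-1 *: (partial ix1 W p - bc_i1 * partial iy1 W p).
Definition dz2 (W : R4 -> BC) (p : R4) : BC :=
  2^-1 *: (partial ix2 W p - bc_i1 * partial iy2 W p).

Definition domega (W : R4 -> BC) (p : R4) : BC :=
  2^-1 *: (dz1 W p - bc_i2 * dz2 W p).
Definition domega_dag2 (W : R4 -> BC) (p : R4) : BC :=
  2^-1 *: (dz1 W p + bc_i2 * dz2 W p).

Definition laplaceC (W : R4 -> BC) (p : R4) : BC :=
  dz1 (dz1 W) p + dz2 (dz2 W) p.

Definition Cop (W : R4 -> BC) (p : R4) : BC := dagger2 (W p).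

Definition toBC (f : R4 -> R[i]) (p : R4) : BC := bc_of_complex (f p).

Definition schrodingerC (nu : R4 -> R[i]) (W : R4 -> BC) (p : R4) : BC :=
  laplaceC W p - toBC nu p * W p.

End Calculus.

(* Main.v *)
Require Import Defs.
From mathcomp Require Import all_boot all_order all_algebra.
From mathcomp Require Import all_classical all_reals all_analysis.
From mathcomp Require Import complex.
From mathcomp Require Import ring lra.
Import Order.TTheory GRing.Theory Num.Theory.
Import numFieldNormedType.Exports.
Local Open Scope classical_set_scope.
Local Open Scope ring_scope.

(** Write [D1], [D2] for the Wirtinger operators on [R[i]]-valued functions
    and put [u_k = D_k f0 / f0], [A_k = D_k phi - u_k * phi].  Since [f0] and
    [phi] have no i2-component,
      [domega f0 / f0 = (u_1 - i2 u_2) / 2]  and  [V = (A_1 - i2 A_2) / 2],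
    and the right-hand side of the factorization expands into
      C(i1)-part:  [D1 A_1 + D2 A_2 + u_1 A_1 + u_2 A_2],
      i2-part:     [D2 A_1 - D1 A_2 + u_1 A_2 - u_2 A_1],
    the factor 4 cancelling the two halves.  In the first line all
    first-order terms in [phi] cancel, and
    [D_k u_k + u_k ^ 2 = D_k D_k f0 / f0], so what is left is
    [(D1 D1 + D2 D2) phi - (D1 D1 f0 + D2 D2 f0) / f0 * phi]; the equation
    satisfied by [f0] turns the last quotient into [nu].  The second line
    reduces to the commutators of [D1] and [D2] on [phi] and on [f0], which
    vanish by the equality of mixed second derivatives.

    The analytic content is therefore that equality ([derive_mixed_comm],
    obtained from the mean value theorem applied to a second difference), its
    transfer to the Wirtinger operators ([wirtinger_comm]), and the product and
    inverse rules ([is_wirtingerM], [is_wirtingerV]).  The expansion itself is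
    a rational identity in the values of the derivatives at one point
    ([factorization_identity]). *)

(** * Equality of mixed directional derivatives *)

Section MixedDerivatives.
Set Implicit Arguments.
Unset Strict Implicit.
Context {R : realType} {V : normedModType R}.
Implicit Types (g : V -> R) (p q v w : V) (P : V -> Prop).

Lemma derivable_translate g c q v :
  derivable g (q + c) v -> derivable (fun x => g (x + c)) q v.
Proof. by rewrite /derivable => d; under eq_fun do rewrite /= -addrA. Qed.

Lemma derive_translate g c q v : 'D_v (fun x => g (x + c)) q = 'D_v g (q + c).
Proof. by rewrite /derive; under eq_fun do rewrite /= -addrA. Qed.

Lemma is_derive_line g q v (x : R) :
  derivable g (q + x *: v) v ->
  is_derive x 1 (fun s : R => g (q + s *: v)) ('D_v g (q + x *: v)).
Proof.
have e : (fun h : R => h^-1 *: (g (q + (h *: 1 + x) *: v) - g (q + x *: v))) =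
         (fun h : R => h^-1 *: (g (h *: v + (q + x *: v)) - g (q + x *: v))).
  apply/funext => h; congr (_ *: (g _ - _)).
  by rewrite [_ *: 1]mulr1 scalerDl addrCA.
by move=> d; split; rewrite /derivable /derive e.
Qed.

Lemma MVT_line g q v (h : R) : 0 < h ->
  (forall s, 0 <= s <= h -> derivable g (q + s *: v) v) ->
  exists2 s, 0 <= s <= h & g (q + h *: v) - g q = h * 'D_v g (q + s *: v).
Proof.
move=> h0 dg.
have [||s sI] := @MVT R (fun s => g (q + s *: v))
  (fun s => 'D_v g (q + s *: v)) 0 h h0.
- move=> x; rewrite in_itv /= => /andP[/ltW x0 /ltW xh].
  by apply: is_derive_line; apply: dg; rewrite x0.
- apply: derivable_within_continuous => x; rewrite in_itv /= => /dg d.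
  exact: (@ex_derive _ _ _ _ _ _ _ (is_derive_line d)).
rewrite scale0r addr0 subr0 mulrC => ->; exists s => //.
by move: sI; rewrite in_itv /= => /andP[/ltW -> /ltW ->].
Qed.

Lemma near_parallelogram p v w P : (\forall q \near p, P q) ->
  \forall h \near 0^'+,
    forall s t : R, 0 <= s <= h -> 0 <= t <= h -> P (p + s *: v + t *: w).
Proof.
move=> /nbhs_ballP[e /= e0 eP].
have K0 : 0 < `|v| + `|w| + 1 by rewrite ltr_pwDr.
near=> h => s t /andP[s0 sh] /andP[t0 th]; apply: eP.
rewrite -ball_normE /= -addrA opprD addrA subrr sub0r normrN.
apply: (@le_lt_trans _ _ (h * (`|v| + `|w| + 1))).
  apply: le_trans (ler_normD _ _) _; rewrite !normrZ !ger0_norm //.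
  have := ler_wpM2r (normr_ge0 v) sh; have := ler_wpM2r (normr_ge0 w) th.
  by rewrite !mulrDr mulr1; lra.
rewrite -ltr_pdivlMr //; near: h; apply: nbhs_right_lt.
by rewrite divr_gt0.
Unshelve. all: by end_near. Qed.

(** Two applications of the mean value theorem, first along [v] to the
    increment of [g] in the direction [w], then along [w] to ['D_v g].  The
    left-hand side is symmetric in [v] and [w] while the right-hand side
    favours one order of differentiation: that asymmetry is what makes mixed
    derivatives comparable.  The predicate [P] locates the intermediate point. *)
Lemma second_difference g p v w P :
  (\forall q \near p, derivable g q v) ->
  (\forall q \near p, derivable ('D_v g) q w) ->
  (\forall q \near p, P q) ->
  \forall h \near 0^'+, exists2 q, P q &
    g (p + h *: v + h *: w) - g (p + h *: v) - (g (p + h *: w) - g p)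
      = h ^+ 2 * 'D_w ('D_v g) q.
Proof.
move=> dv dw nP.
have nI := near_parallelogram v w (filterI dv (filterI dw nP)).
near=> h.
have h0 : 0 < h by near: h; exact: nbhs_right_gt.
have hI : forall s t : R, 0 <= s <= h -> 0 <= t <= h ->
    derivable g (p + s *: v + t *: w) v /\
    (derivable ('D_v g) (p + s *: v + t *: w) w /\ P (p + s *: v + t *: w)).
  by near: h; exact: nI.
have hh : 0 <= h <= h by rewrite ltW /=.
have h00 : 0 <= (0 : R) <= h by rewrite lexx ltW.
pose G x := g (x + h *: w) - g x.
have dG s : 0 <= s <= h ->
  is_derive (p + s *: v) v G
    ('D_v g (p + s *: v + h *: w) - 'D_v g (p + s *: v)).
  move=> sh; apply: is_deriveB.
  - split; last exact: derive_translate.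
    by apply: derivable_translate; case: (hI _ _ sh hh).
  - apply: derivableP; have [] := hI _ _ sh h00.
    by rewrite scale0r addr0.
have [s sh es] := MVT_line h0 (fun s sh => @ex_derive _ _ _ _ _ _ _ (dG s sh)).
have [t th et] := MVT_line h0 (fun t th => (hI s t sh th).2.1).
exists (p + s *: v + t *: w); first exact: (hI s t sh th).2.2.
transitivity (G (p + h *: v) - G p); first by rewrite /G.
by rewrite es (@derive_val _ _ _ _ _ _ _ (dG s sh)) et mulrA.
Unshelve. all: by end_near. Qed.

(** For small [h] the same second difference is [h ^+ 2] times each of the two
    mixed derivatives, taken at points where they are within [e / 2] of their
    values at [p]; these values thus differ by less than [e]. *)
Lemma derive_mixed_comm g p v w :
  (\forall q \near p, derivable g q v) ->
  (\forall q \near p, derivable g q w) ->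
  (\forall q \near p, derivable ('D_v g) q w) ->
  (\forall q \near p, derivable ('D_w g) q v) ->
  {for p, continuous ('D_w ('D_v g))} -> {for p, continuous ('D_v ('D_w g))} ->
  'D_w ('D_v g) p = 'D_v ('D_w g) p.
Proof.
move=> dv dw dvw dwv cvw cwv.
apply/eqP; rewrite -subr_eq0 -normr_le0; apply/ler_addgt0Pr => e e0.
have e2 : 0 < e / 2 by rewrite divr_gt0.
move: cvw cwv => /cvgrPdist_lt /(_ _ e2) cvw /cvgrPdist_lt /(_ _ e2) cwv.
have n1 := second_difference dv dvw cvw.
have n2 := second_difference dw dwv cwv.
have [h [[h0 [q qe Eq]] [r re Er]]] :=
  filter_ex (filterI (filterI (nbhs_right_gt 0) n1) n2).
have h2 : h ^+ 2 != 0 by rewrite expf_neq0 // gt_eqF.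
have E : 'D_w ('D_v g) q = 'D_v ('D_w g) r.
  apply: (mulfI h2); apply: etrans (esym Eq) (etrans _ Er).
  by rewrite (addrAC p (h *: w)); ring.
move: E qe re {Eq Er n1 n2 cvw cwv}.
move: ('D_w ('D_v g) p) ('D_v ('D_w g) p) => x y.
move: ('D_w ('D_v g) q) ('D_v ('D_w g) r) => a b ->.
rewrite !ltr_distl => /andP[? ?] /andP[? ?].
by rewrite add0r ler_norml; apply/andP; split; lra.
Qed.

End MixedDerivatives.

(** * Directional derivatives of complex-valued functions *)

Local Open Scope complex_scope.

Section ComplexDerivative.
Set Implicit Arguments.
Unset Strict Implicit.
Context {R : realType} {V : normedModType R}.
Implicit Types (f g : V -> R[i]) (p v : V) (l m : R[i]).

(** Differentiability and value are kept in one relation, so that a derivative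
    of a compound expression is obtained, with its existence, by composing the
    rules below. *)
Definition is_cderive v f p l : Prop :=
  is_derive p v (fun q => complex.Re (f q)) (complex.Re l) /\
  is_derive p v (fun q => complex.Im (f q)) (complex.Im l).

Lemma ReM (x y : R[i]) : complex.Re (x * y) =
  complex.Re x * complex.Re y - complex.Im x * complex.Im y.
Proof. by case: x; case: y. Qed.

Lemma ImM (x y : R[i]) : complex.Im (x * y) =
  complex.Re x * complex.Im y + complex.Im x * complex.Re y.
Proof. by case: x; case: y. Qed.

Lemma is_cderive_cst v p (c : R[i]) : is_cderive v (fun=> c) p 0.
Proof. by split; exact: is_derive_cst. Qed.

Lemma is_cderiveB v f g p l m : is_cderive v f p l -> is_cderive v g p m ->
  is_cderive v (fun q => f q - g q) p (l - m).
Proof.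
move=> [rf jf] [rg jg]; split.
- by under eq_fun do rewrite raddfB; rewrite raddfB; exact: is_deriveB.
- by under eq_fun do rewrite raddfB; rewrite raddfB; exact: is_deriveB.
Qed.

Lemma is_cderiveM v f g p l m : is_cderive v f p l -> is_cderive v g p m ->
  is_cderive v (fun q => f q * g q) p (l * g p + f p * m).
Proof.
move=> [rf jf] [rg jg]; split.
- under eq_fun do rewrite ReM; rewrite raddfD /= !ReM.
  apply: (is_derive_eq (is_deriveB (is_deriveM rf rg) (is_deriveM jf jg))).
  by rewrite /GRing.scale /=; ring.
- under eq_fun do rewrite ImM; rewrite raddfD /= !ImM.
  apply: (is_derive_eq (is_deriveD (is_deriveM rf jg) (is_deriveM jf rg))).
  by rewrite /GRing.scale /=; ring.
Qed.

Lemma is_cderiveV v f p l : f p != 0 -> is_cderive v f p l ->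
  is_cderive v (fun q => (f q)^-1) p (- l / f p ^+ 2).
Proof.
move=> fp [rf jf].
pose n q := complex.Re (f q) ^+ 2 + complex.Im (f q) ^+ 2.
have np : n p != 0.
  rewrite paddr_eq0 ?sqr_ge0 // !sqrf_eq0; apply: contra fp => /andP[x y].
  by rewrite eq_complex x y.
pose n' := 2 * complex.Re (f p) * complex.Re l +
           2 * complex.Im (f p) * complex.Im l.
have dn : is_derive p v n n'.
  apply: (is_derive_eq (is_deriveD (is_deriveX 2 rf) (is_deriveX 2 jf))).
  by rewrite /GRing.scale /= !expr1.
have dV : is_derive p v (fun q => (n q)^-1) (- (n p) ^- 2 * n').
  split; first exact: derivableV (@ex_derive _ _ _ _ _ _ _ dn).
  by rewrite deriveV // (@derive_val _ _ _ _ _ _ _ dn).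
have Re_inv q : complex.Re (f q)^-1 = complex.Re (f q) * (n q)^-1.
  by rewrite /n; case: (f q).
have Im_inv q : complex.Im (f q)^-1 = - (complex.Im (f q) * (n q)^-1).
  by rewrite /n; case: (f q).
(* The denominator produced by [f p ^+ 2] is the square of [n p]. *)
have normsq (x y : R) : x ^+ 2 + y ^+ 2 != 0 ->
  (x * x - y * y) * (x * x - y * y) + (x * y + y * x) * (x * y + y * x) != 0.
  move=> xy; rewrite (_ : _ + _ = (x ^+ 2 + y ^+ 2) ^+ 2); last by ring.
  by rewrite expf_neq0.
split.
- cbv beta; rewrite (funext Re_inv).
  apply: (is_derive_eq (is_deriveM rf dV)).
  move: np; rewrite /n /n' /GRing.scale /=.
  case: (f p) (l) => x y [c d] /= np.
  by rewrite !expr2 /=; field; rewrite normsq // -!expr2.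
- cbv beta; rewrite (funext Im_inv).
  apply: (is_derive_eq (is_deriveN (is_deriveM jf dV))).
  move: np; rewrite /n /n' /GRing.scale /=.
  case: (f p) (l) => x y [c d] /= np.
  by rewrite !expr2 /=; field; rewrite normsq // -!expr2.
Qed.

End ComplexDerivative.

(** * Wirtinger operators on complex-valued functions *)

Section Wirtinger.
Set Implicit Arguments.
Unset Strict Implicit.
Context {R : realType}.
Local Notation R4 := 'rV[R]_4.
Implicit Types (f g : R4 -> R[i]) (p : R4) (k : 'I_4 * 'I_4) (l m : R[i]).

(** The pair [k] holds the indices of the real and imaginary parts of one
    complex coordinate, so that [(ix1, iy1)] and [(ix2, iy2)] give the
    derivatives in z1 and z2. *)
Definition wirtinger k f p : R[i] :=
  (2^-1)%:C * (partial_complex k.1 f p - 'i%C * partial_complex k.2 f p).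

Definition is_wirtinger k f p l : Prop :=
  exists2 d : R[i] * R[i],
    is_cderive (basis4 k.1) f p d.1 /\ is_cderive (basis4 k.2) f p d.2 &
    l = (2^-1)%:C * (d.1 - 'i%C * d.2).

Lemma is_cderive_partial (j : 'I_4) f p l :
  is_cderive (basis4 j) f p l -> partial_complex j f p = l.
Proof.
by case: l => a b [[_ /= ra] [_ /= rb]]; rewrite /partial_complex ra rb.
Qed.

Lemma is_wirtinger_val k f p l : is_wirtinger k f p l -> wirtinger k f p = l.
Proof.
case=> d [/is_cderive_partial d1 /is_cderive_partial d2] ->.
by rewrite /wirtinger d1 d2.
Qed.

Lemma is_wirtinger_cst k p (c : R[i]) : is_wirtinger k (fun=> c) p 0.
Proof.
exists (0, 0); first by split; exact: is_cderive_cst.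
by rewrite /= mulr0 subr0 mulr0.
Qed.

Lemma is_wirtingerB k f g p l m : is_wirtinger k f p l -> is_wirtinger k g p m ->
  is_wirtinger k (fun q => f q - g q) p (l - m).
Proof.
move=> [d [d1 d2] ->] [e [e1 e2] ->]; exists (d.1 - e.1, d.2 - e.2).
  by split; exact: is_cderiveB.
by rewrite /=; ring.
Qed.

Lemma is_wirtingerM k f g p l m : is_wirtinger k f p l -> is_wirtinger k g p m ->
  is_wirtinger k (fun q => f q * g q) p (l * g p + f p * m).
Proof.
move=> [d [d1 d2] ->] [e [e1 e2] ->].
exists (d.1 * g p + f p * e.1, d.2 * g p + f p * e.2).
  by split; exact: is_cderiveM.
by rewrite /=; ring.
Qed.

Lemma is_wirtingerV k f p l : f p != 0 -> is_wirtinger k f p l ->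
  is_wirtinger k (fun q => (f q)^-1) p (- l / f p ^+ 2).
Proof.
move=> fp [d [d1 d2] ->].
exists (- d.1 / f p ^+ 2, - d.2 / f p ^+ 2).
  by split; exact: is_cderiveV.
by rewrite /=; ring.
Qed.

Lemma class_C_derive_comm (Omega : set R4) (g : R4 -> R) (i j : 'I_4) p :
  open Omega -> class_C 2 Omega g -> Omega p ->
  'D_(basis4 i) ('D_(basis4 j) g) p = 'D_(basis4 j) ('D_(basis4 i) g) p.
Proof.
move=> oO [_ g2] Op; have nO := open_nbhs_nbhs (conj oO Op).
have [di [_ /(_ j)[dij [cij _]]]] := g2 i.
have [dj [_ /(_ i)[dji [cji _]]]] := g2 j.
apply: derive_mixed_comm; [| | | |exact: cji|exact: cij].
- by apply: filterS nO => q /dj.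
- by apply: filterS nO => q /di.
- by apply: filterS nO => q /dji.
- by apply: filterS nO => q /dij.
Qed.

Section TwiceDifferentiable.
Variables (Omega : set R4) (f : R4 -> R[i]).
Hypothesis f_C2 : class_C_complex 2 Omega f.

Lemma is_cderive_C2 (j : 'I_4) p : Omega p ->
  is_cderive (basis4 j) f p (partial_complex j f p).
Proof.
case: f_C2 => [[_ rf] [_ jf]] Op; split; apply: derivableP.
- by case: (rf j) => d _; apply: d.
- by case: (jf j) => d _; apply: d.
Qed.

Lemma is_cderive2_C2 (i j : 'I_4) p : Omega p ->
  is_cderive (basis4 i) (partial_complex j f) p
    (partial_complex i (partial_complex j f) p).
Proof.
case: f_C2 => [[_ rf] [_ jf]] Op; split; apply: derivableP.
- by case: (rf j) => _ [_ /(_ i)[d _]]; apply: d.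
- by case: (jf j) => _ [_ /(_ i)[d _]]; apply: d.
Qed.

Lemma is_wirtinger_C2 k p : Omega p -> is_wirtinger k f p (wirtinger k f p).
Proof.
move=> Op; exists (partial_complex k.1 f p, partial_complex k.2 f p) => //.
by split; exact: is_cderive_C2.
Qed.

Lemma is_cderive_wirtinger (j : 'I_4) k p : Omega p ->
  is_cderive (basis4 j) (wirtinger k f) p
    ((2^-1)%:C * (partial_complex j (partial_complex k.1 f) p -
                  'i%C * partial_complex j (partial_complex k.2 f) p)).
Proof.
move=> Op.
have := is_cderiveM (is_cderive_cst (basis4 j) p (2^-1)%:C)
  (is_cderiveB (is_cderive2_C2 j k.1 Op)
    (is_cderiveM (is_cderive_cst (basis4 j) p 'i%C) (is_cderive2_C2 j k.2 Op))).
by rewrite !mul0r !add0r.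
Qed.

Lemma is_wirtinger2_C2 k k' p : Omega p ->
  is_wirtinger k' (wirtinger k f) p (wirtinger k' (wirtinger k f) p).
Proof.
move=> Op; have d1 := is_cderive_wirtinger k'.1 k Op.
have d2 := is_cderive_wirtinger k'.2 k Op.
eexists (_, _); first by split; [exact: d1 | exact: d2].
by rewrite /wirtinger (is_cderive_partial d1) (is_cderive_partial d2).
Qed.

Hypothesis Omega_open : open Omega.

Lemma partial_complex_comm (i j : 'I_4) p : Omega p ->
  partial_complex i (partial_complex j f) p =
  partial_complex j (partial_complex i f) p.
Proof.
case: f_C2 => rf jf Op; rewrite /partial_complex /=.
by rewrite (class_C_derive_comm i j Omega_open rf Op)
           (class_C_derive_comm i j Omega_open jf Op).
Qed.

Lemma wirtinger_comm k k' p : Omega p ->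
  wirtinger k' (wirtinger k f) p = wirtinger k (wirtinger k' f) p.
Proof.
move=> Op.
(* Both sides are the same polynomial in the second partial derivatives at
   [p], of which only the symmetry in the two indices matters. *)
have [P PC PE] : exists2 P : 'I_4 -> 'I_4 -> R[i],
    (forall i j, P i j = P j i) &
    forall k k', wirtinger k' (wirtinger k f) p =
      (2^-1)%:C * ((2^-1)%:C * (P k'.1 k.1 - 'i%C * P k'.1 k.2) -
             'i%C * ((2^-1)%:C * (P k'.2 k.1 - 'i%C * P k'.2 k.2))).
  exists (fun i j => partial_complex i (partial_complex j f) p).
    by move=> i j; exact: partial_complex_comm.
  move=> l l'; rewrite {1}/wirtinger.
  by rewrite !(is_cderive_partial (is_cderive_wirtinger _ _ Op)).
rewrite !PE (PC k'.1 k.1) (PC k'.1 k.2) (PC k'.2 k.1) (PC k'.2 k.2).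
by ring.
Qed.

End TwiceDifferentiable.
End Wirtinger.

(** * Bicomplex operators in components *)

Section BicomplexOperators.
Set Implicit Arguments.
Unset Strict Implicit.
Context {R : realType}.
Local Notation R4 := 'rV[R]_4.
Local Notation D1 := (wirtinger (ix1, iy1)).
Local Notation D2 := (wirtinger (ix2, iy2)).
Implicit Types (W : R4 -> bicomplex R) (p : R4) (f : R4 -> R[i]).

Lemma half_sub_i1 (x x' y y' : R[i]) :
  2^-1 *: (BiComplex x x' - bc_i1 * BiComplex y y') =
  BiComplex ((2^-1)%:C * (x - 'i%C * y)) ((2^-1)%:C * (x' - 'i%C * y')).
Proof. by apply: bc_eq; rewrite /GRing.scale /=; ring. Qed.

Lemma half_sub_i2 (x x' y y' : R[i]) :
  2^-1 *: (BiComplex x x' - bc_i2 * BiComplex y y') =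
  BiComplex ((2^-1)%:C * (x + y')) ((2^-1)%:C * (x' - y)).
Proof. by apply: bc_eq; rewrite /GRing.scale /=; ring. Qed.

Lemma half_add_i2 (x x' y y' : R[i]) :
  2^-1 *: (BiComplex x x' + bc_i2 * BiComplex y y') =
  BiComplex ((2^-1)%:C * (x - y')) ((2^-1)%:C * (x' + y)).
Proof. by apply: bc_eq; rewrite /GRing.scale /=; ring. Qed.

Lemma dz1E W p :
  dz1 W p = BiComplex (D1 (fun q => bc1 (W q)) p) (D1 (fun q => bc2 (W q)) p).
Proof. exact: half_sub_i1. Qed.

Lemma dz2E W p :
  dz2 W p = BiComplex (D2 (fun q => bc1 (W q)) p) (D2 (fun q => bc2 (W q)) p).
Proof. exact: half_sub_i1. Qed.

Lemma domega_dag2_val W p a b c d :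
  is_wirtinger (ix1, iy1) (fun q => bc1 (W q)) p a ->
  is_wirtinger (ix2, iy2) (fun q => bc1 (W q)) p b ->
  is_wirtinger (ix1, iy1) (fun q => bc2 (W q)) p c ->
  is_wirtinger (ix2, iy2) (fun q => bc2 (W q)) p d ->
  domega_dag2 W p = BiComplex ((2^-1)%:C * (a - d)) ((2^-1)%:C * (c + b)).
Proof.
move=> /is_wirtinger_val ea /is_wirtinger_val eb.
move=> /is_wirtinger_val ec /is_wirtinger_val ed.
by rewrite /domega_dag2 dz1E dz2E half_add_i2 ea eb ec ed.
Qed.

Lemma wirtinger_toBC2 k f p : wirtinger k (fun q => bc2 (toBC f q)) p = 0.
Proof. exact: is_wirtinger_val (is_wirtinger_cst _ _ _). Qed.

Lemma domega_toBC f p :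
  domega (toBC f) p = BiComplex ((2^-1)%:C * D1 f p) (- ((2^-1)%:C * D2 f p)).
Proof.
by rewrite /domega dz1E dz2E half_sub_i2 !wirtinger_toBC2 addr0 sub0r mulrN.
Qed.

Lemma laplaceC_toBC f p :
  laplaceC (toBC f) p = bc_of_complex (D1 (D1 f) p + D2 (D2 f) p).
Proof.
have -> : laplaceC (toBC f) p = dz1 (toBC (D1 f)) p + dz2 (toBC (D2 f)) p.
  have e1 : dz1 (toBC f) = toBC (D1 f).
    by apply/funext => q; rewrite dz1E wirtinger_toBC2.
  have e2 : dz2 (toBC f) = toBC (D2 f).
    by apply/funext => q; rewrite dz2E wirtinger_toBC2.
  by rewrite /laplaceC e1 e2.
by rewrite dz1E dz2E !wirtinger_toBC2; apply: bc_eq; rewrite /= ?addr0.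
Qed.

Lemma schrodingerC_toBC nu f p : schrodingerC nu (toBC f) p =
  bc_of_complex (D1 (D1 f) p + D2 (D2 f) p - nu p * f p).
Proof.
have H (x y z : R[i]) : bc_of_complex x - bc_of_complex y * bc_of_complex z =
  bc_of_complex (x - y * z) by apply: bc_eq => /=; ring.
by rewrite /schrodingerC laplaceC_toBC H.
Qed.

(** Holds at [z = 0] as well, both total inverses of 0 being 0; quotients by
    [f0] can therefore be rewritten as functions on the whole space, zeros of
    [f0] outside the domain included. *)
Lemma bc_of_complexV (z : R[i]) : (bc_of_complex z)^-1 = bc_of_complex z^-1.
Proof.
have [->|z0] := eqVneq z 0; first by rewrite [in RHS]invr0; exact: invr0.
have zU : bc_of_complex z \is a GRing.unit by rewrite bc_of_complex_unit.
apply: (mulrI zU); rewrite divrr //.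
by apply: bc_eq; rewrite /= !mul0r ?mulr0 ?subr0 ?addr0 ?divff.
Qed.

(** * The factorization *)

(** The pointwise content of the factorization: [f0] and [g0] stand for
    the values of the two functions, [fj], [fij], [gj], [gij] for those of
    their first and second Wirtinger derivatives, and [dV] for the derivative
    of the function [gi - fi / f0 * g0] in the j-th complex variable.  One
    symbol [f12], [g12] serves both orders of differentiation, which is what
    kills the i2-component. *)
Lemma factorization_identity
    (f0 f1 f2 f11 f12 f22 g0 g1 g2 g11 g12 g22 nu : R[i]) :
  f0 != 0 -> f11 + f22 = nu * f0 ->
  let h : R[i] := (2^-1)%:C in
  let dV gij fij fi fj gj :=
    gij - ((fij * f0^-1 + fi * (- fj / f0 ^+ 2)) * g0 + fi * f0^-1 * gj) in
  bc_of_complex (g11 + g22 - nu * g0) =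
  4 *: (BiComplex (h * (h * dV g11 f11 f1 f1 g1 - - h * dV g22 f22 f2 f2 g2))
                  (h * (- h * dV g12 f12 f2 f1 g1 + h * dV g12 f12 f1 f2 g2))
        + BiComplex (h * (f1 * f0^-1)) (- h * (f2 * f0^-1)) *
          dagger2 (BiComplex (h * (g1 - f1 * f0^-1 * g0))
                             (- h * (g2 - f2 * f0^-1 * g0)))).
Proof.
move=> f0n0 sol.
have -> : nu = (f11 + f22) / f0 by rewrite sol mulfK.
have e2 : ((2^-1)%:C : R[i]) = 2^-1 by rewrite fmorphV rmorph_nat.
have e4 : (4%:C : R[i]) = 4 by rewrite rmorph_nat.
by rewrite /= e2; apply: bc_eq; rewrite /GRing.scale /= e4; field.
Qed.

End BicomplexOperators.

Local Close Scope complex_scope.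

Theorem theorem14 (R : realType) (Omega : set 'rV[R]_4) (hOmega : open Omega)
  (nu f0 : 'rV[R]_4 -> R[i])
  (f0_C2 : class_C_complex 2 Omega f0)
  (f0_neq0 : forall p, Omega p -> f0 p <> 0)
  (f0_sol : forall p, Omega p -> schrodingerC nu (toBC f0) p = 0)
  (phi : 'rV[R]_4 -> R[i])
  (phi_C2 : class_C_complex 2 Omega phi) :
  let a : 'rV[R]_4 -> bicomplex R :=
    fun p => domega (toBC f0) p / toBC f0 p in
  let V : 'rV[R]_4 -> bicomplex R :=
    fun p => domega (toBC phi) p - a p * Cop (toBC phi) p in
  forall p, Omega p ->
    schrodingerC nu (toBC phi) p =
    4 *: (domega_dag2 V p + a p * Cop V p).
Proof.
move=> a V p Op.
pose D k (g : 'rV[R]_4 -> R[i]) := wirtinger k g.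
pose k1 : 'I_4 * 'I_4 := (ix1, iy1); pose k2 : 'I_4 * 'I_4 := (ix2, iy2).
pose h : R[i] := (2^-1)%:C%C.
pose A k q := D k phi q - D k f0 q * (f0 q)^-1 * phi q.
have aE q : a q = BiComplex (h * (D k1 f0 q * (f0 q)^-1))
                            (- h * (D k2 f0 q * (f0 q)^-1)).
  have H (x y z : R[i]) : BiComplex (h * x) (- (h * y)) * bc_of_complex z =
    BiComplex (h * (x * z)) (- h * (y * z)) by apply: bc_eq => /=; ring.
  by rewrite /a domega_toBC bc_of_complexV H.
have VE q : V q = BiComplex (h * A k1 q) (- h * A k2 q).
  have H (x y u v z : R[i]) : BiComplex (h * x) (- (h * y)) -
      BiComplex (h * u) (- h * v) * dagger2 (bc_of_complex z) =
    BiComplex (h * (x - u * z)) (- h * (y - v * z)) by apply: bc_eq => /=; ring.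
  by rewrite /V aE domega_toBC H.
have f0p : f0 p != 0 by apply/eqP/f0_neq0.
have dA c k k' fij gij :
    D k' (D k f0) p = fij -> D k' (D k phi) p = gij ->
    is_wirtinger k' (fun q => c * A k q) p
      (c * (gij - ((fij * (f0 p)^-1 + D k f0 p * (- D k' f0 p / f0 p ^+ 2))
                     * phi p + D k f0 p * (f0 p)^-1 * D k' phi p))).
  move=> <- <-.
  have := is_wirtingerM (is_wirtinger_cst k' p c)
    (is_wirtingerB (is_wirtinger2_C2 phi_C2 k k' Op)
      (is_wirtingerM
        (is_wirtingerM (is_wirtinger2_C2 f0_C2 k k' Op)
          (is_wirtingerV f0p (is_wirtinger_C2 f0_C2 k' Op)))
        (is_wirtinger_C2 phi_C2 k' Op))).
  by rewrite mul0r add0r.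
have sol : D k1 (D k1 f0) p + D k2 (D k2 f0) p = nu p * f0 p.
  have := f0_sol p Op; rewrite schrodingerC_toBC => /(congr1 (@bc1 _)) /= /eqP.
  by rewrite subr_eq0 => /eqP.
have cf := wirtinger_comm f0_C2 hOmega k2 k1 Op.
have cphi := wirtinger_comm phi_C2 hOmega k2 k1 Op.
have dV := @domega_dag2_val _ (fun q => BiComplex (h * A k1 q) (- h * A k2 q)) p
  _ _ _ _ (dA h k1 k1 _ _ erefl erefl) (dA h k1 k2 _ _ erefl erefl)
  (dA (- h) k2 k1 _ _ cf cphi) (dA (- h) k2 k2 _ _ erefl erefl).
rewrite schrodingerC_toBC /Cop aE VE (funext VE) dV.
exact: factorization_identity f0p sol.
Qed.
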